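(* Let $G_0=(V,E)$ be a finite simple graph and let $F$ be a subgraph of $G_0$, regarded as having vertex set $V$, with $\delta(G_0-E(F))\geq \Delta(F)$, such that $|E(G_0-E(F))|\geq |V|-1$ when $\delta(G_0)=1$. Then there is a simple graph $G$ on the vertex set $V$ with $\deg_G(v)=\deg_{G_0}(v)$ for every $v\in V$ and $E(F)\subseteq E(G)$ (that is, $G\in\mathcal{R}(G_0,F)$) such that $G-E(F)$ is maximally edge-connected when $\delta(G-E(F))$ is even, and $G-E(F)$ is $(\delta(G-E(F))-1)$-edge-connected when $\delta(G-E(F))$ is odd.
   Context: All graphs are finite and simple. For a graph $G$, $\deg_G(v)$ is the degree of $v$, $\delta(G)$ and $\Delta(G)$ are the minimum and maximum degrees, and $\lambda(G)$ is the edge-connectivity. $G$ is maximally edge-connected if $\lambda(G)=\delta(G)$, and $G$ is $m$-edge-connected if $\lambda(G)\geq m$ (every graph is $0$-edge-connected). For a set $M$ of edges, $G-M$ is the graph on the same vertex set with the edges of $M$ removed. $\mathcal{R}(G_0,F)$ denotes the set of all simple graphs $G$ on $V$ with $\deg_G(v)=\deg_{G_0}(v)$ for all $v\in V$ and $E(F)\subseteq E(G)$. *)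

(* Defs.v *)
From mathcomp Require Import all_boot.
Set Implicit Arguments.
Unset Strict Implicit.
Unset Printing Implicit Defensive.

Record sgraph (V : finType) := SGraph {
  adj :> rel V;
  adj_sym : symmetric adj;
  adj_irrefl : irreflexive adj
}.

Section Graph.
Variable V : finType.
Implicit Types (G F : sgraph V) (M : {set {set V}}).

Definition edges G : {set {set V}} := [set [set x; y] | x in V, y in G x].

Definition deg G (v : V) : nat := #|[set w | G v w]|.

(* Every degree is smaller than #|V|, so the default value #|V| of the minimum
   is attained only if V is empty, where the minimum degree is then 0. *)
Definition min_degree G : nat := \big[minn/#|V|]_(v : V) deg G v.

Definition max_degree G : nat := \max_(v : V) deg G v.

Definition del_rel G M : rel V := fun x y => G x y && ([set x; y] \notin M).

Lemma del_rel_sym G M : symmetric (del_rel G M).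
Proof. by move=> x y; rewrite /del_rel adj_sym setUC. Qed.

Lemma del_rel_irrefl G M : irreflexive (del_rel G M).
Proof. by move=> x; rewrite /del_rel adj_irrefl. Qed.

Definition del_edges G M : sgraph V :=
  SGraph (del_rel_sym G M) (del_rel_irrefl G M).

Definition connected G : bool := [forall x, forall y, connect G x y].

(* The least size of a set of edges whose removal disconnects G.  If V has at
   least two vertices, then M = edges G is such a set, so the default value
   #|edges G| does not affect the minimum.  If V has at most one vertex, no
   such set exists and the value is #|edges G| = 0, the usual convention for
   the one-vertex graph. *)
Definition edge_connectivity G : nat :=
  \big[minn/#|edges G|]_(M : {set {set V}} |
      (M \subset edges G) && ~~ connected (del_edges G M)) #|M|.

Definition maximally_edge_connected G : Prop :=
  edge_connectivity G = min_degree G.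

Definition m_edge_connected (m : nat) G : Prop := m <= edge_connectivity G.

Definition realization G0 F G : Prop :=
  (forall v : V, deg G v = deg G0 v) /\ edges F \subset edges G.

End Graph.

(* Main.v *)
Require Import Defs.
From mathcomp Require Import all_boot.
From mathcomp Require Import zify.

Set Implicit Arguments.
Unset Strict Implicit.
Unset Printing Implicit Defensive.

(** Put [H = G0 - E(F)], let [delta] be its minimum degree and let [k] be the
    largest even number that is at most [delta]. A realization [G] containing
    [F] is the same thing as a graph [G - E(F)] that has the degrees of [H] and
    shares no edge with [F]; so it suffices to reach, from [H] and by
    degree-preserving switches that keep clear of [F], a graph in which every
    nonempty proper vertex set is left by at least [k] edges.

    Suppose that some [Y] is left by fewer than [k] edges. Choose
    inclusion-minimal nonempty sets [S] inside [Y] and [T] inside the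
    complement of [Y] that are also left by fewer than [k] edges. A switch
    replaces an edge [ab] inside [S] and an edge [cd] inside [T] by [ad] and
    [cb], so it adds two edges to the cuts of [S] and of [T].

    - Such a switch exists ([exists_switch]). A nonempty set left by fewer than [delta]
      edges has more than [delta] vertices, hence has vertices without
      neighbours outside the set. For such vertices the only obstruction to a
      switch is [F], whose degrees, being at most [delta], do not exceed the
      degrees of [H]; this leaves room to avoid it.

    - No cut drops below [k] or, if it is below [k], gets smaller
      ([deficiency_decrease]). The switch can only shrink the cut of a set [Z]
      that separates [a] from [b] and [c] from [d], and then by two. Such a [Z]
      splits both [S] and [T] into nonempty parts, which by minimality are left
      by at least [k] edges each. Counting shows that more than [k / 2] edges
      join the two parts of [S]; as [k] is even there are at least [k / 2 + 1]
      of them. The same holds for [T], so that at least [k + 2] edges leave [Z]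
      before the switch. This is the only place where the parity of [k]
      matters.

    Hence the total deficiency of the cuts below [k] drops at each switch, and
    the process stops at the desired graph ([exists_highly_connected]). A set
    of edges whose removal disconnects a graph contains a whole cut, so the
    edge-connectivity is at least [k]; if [delta] is even, then [k = delta] and
    the edges at a vertex of minimum degree give the reverse inequality. *)

(** * Counting edges between vertex sets *)

Section EdgeCounts.
Variable V : finType.
Implicit Types (r : rel V) (S T X Y : {set V}).

(** Counts ordered pairs, so for a symmetric relation an edge with both ends in
    [S :&: T] contributes twice. *)
Definition ecount r S T : nat := \sum_(x in S) \sum_(y in T) (r x y : nat).

Definition cut r X : nat := ecount r X (~: X).

Lemma eq_ecount r1 r2 S T : r1 =2 r2 -> ecount r1 S T = ecount r2 S T.
Proof. by move=> e; do 2 apply: eq_bigr => ? _; rewrite e. Qed.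

Lemma ecount_sym r S T : symmetric r -> ecount r S T = ecount r T S.
Proof.
move=> sr; rewrite /ecount exchange_big /=.
by apply: eq_bigr => x _; apply: eq_bigr => y _; rewrite sr.
Qed.

Lemma cutC r X : symmetric r -> cut r (~: X) = cut r X.
Proof. by move=> sr; rewrite /cut setCK ecount_sym. Qed.

Lemma sum_setU S T (f : V -> nat) : [disjoint S & T] ->
  \sum_(x in S :|: T) f x = \sum_(x in S) f x + \sum_(x in T) f x.
Proof. by move=> dST; rewrite -bigU //; apply: eq_bigl => x; rewrite !inE. Qed.

Lemma ecountUl r S1 S2 T : [disjoint S1 & S2] ->
  ecount r (S1 :|: S2) T = ecount r S1 T + ecount r S2 T.
Proof. by move=> dS; apply: sum_setU. Qed.

Lemma ecountUr r S T1 T2 : [disjoint T1 & T2] ->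
  ecount r S (T1 :|: T2) = ecount r S T1 + ecount r S T2.
Proof.
by move=> dT; rewrite -big_split /=; apply: eq_bigr => x _; rewrite sum_setU.
Qed.

Lemma leq_ecount r S1 S2 T1 T2 : S1 \subset S2 -> T1 \subset T2 ->
  ecount r S1 T1 <= ecount r S2 T2.
Proof.
move=> /subsetP sS /subsetP sT; rewrite /ecount big_mkcond [leqRHS]big_mkcond.
apply: leq_sum => x _; case: ifP => // /sS ->.
rewrite big_mkcond [leqRHS]big_mkcond.
by apply: leq_sum => y _; case: ifP => // /sT ->.
Qed.

Lemma ecount_pair a b S T :
  ecount (fun x y => (x == a) && (y == b)) S T = (a \in S) && (b \in T).
Proof.
have sum_eq (c : V) (U : {set V}) : \sum_(x in U) ((x == c) : nat) = (c \in U).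
  case: (boolP (c \in U)) => cU.
    by rewrite (bigD1 c) //= eqxx big1 // => x /andP[_ /negPf->].
  by rewrite big1 // => x xU; rewrite (negPf (memPn cU x xU)).
transitivity (\sum_(x in S) (x == a) * (b \in T)).
  apply: eq_bigr => x _; case: eqP => _ /=; last by rewrite mul0n big1.
  by rewrite mul1n sum_eq.
by rewrite -big_distrl /= sum_eq mulnb.
Qed.

(** The edges between [A] and [B] leave both sets but do not leave their union;
    every other edge is counted equally often on the two sides. *)
Lemma cut_split r (A B : {set V}) : symmetric r -> [disjoint A & B] ->
  cut r A + cut r B = cut r (A :|: B) + 2 * ecount r A B.
Proof.
move=> sr dAB; rewrite /cut.
have eA : ~: A = B :|: ~: (A :|: B).
  apply/setP => x; rewrite !inE; case xA: (x \in A) => //=.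
    by rewrite (disjointFr dAB xA).
  by case: (x \in B).
have eB : ~: B = A :|: ~: (A :|: B).
  apply/setP => x; rewrite !inE; case xA: (x \in A) => //=.
  by rewrite (disjointFr dAB xA).
have dC (C : {set V}) : C \subset A :|: B -> [disjoint C & ~: (A :|: B)].
  by move=> sC; rewrite -subsets_disjoint.
rewrite {1}eA eB !ecountUr ?dC ?subsetUl ?subsetUr // ecountUl //.
by rewrite (ecount_sym B A sr); lia.
Qed.

End EdgeCounts.

(** * Sets left by few edges, and the existence of a switch *)

Section Degrees.
Variable V : finType.
Implicit Types (H F G : sgraph V) (S T X Y : {set V}).

Lemma degE G v : deg G v = \sum_y (G v y : nat).
Proof. by rewrite /deg -sum1dep_card big_mkcond. Qed.

Definition interior G (X : {set V}) : {set V} := [set x in X | [forall y, G x y ==> (y \in X)]].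

Lemma interiorP G X x y : x \in interior G X -> G x y -> y \in X.
Proof. by rewrite inE => /andP[_ /forallP/(_ y)/implyP]. Qed.

Lemma interiorS G X x : x \in interior G X -> x \in X.
Proof. by rewrite inE => /andP[]. Qed.

(** If [S] misses the interior of [X], each vertex of [S] is the end of an edge
    leaving [X], and these edges are distinct. *)
Lemma meet_interior G X S : S \subset X -> cut G X < #|S| ->
  exists2 x, x \in S & x \in interior G X.
Proof.
move=> sSX ltS.
case: (pickP [pred x in S | x \in interior G X]) => [x /andP[] | none].
  by exists x.
suff: #|S| <= cut G X by lia.
apply: leq_trans (leq_ecount G sSX (subxx _)).
rewrite -sum1_card; apply: leq_sum => x xS.
have := none x; rewrite /= xS inE (subsetP sSX) //=.
move/negbT/forallPn => [y]; rewrite negb_imply => /andP[Gxy yX].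
by rewrite (bigD1 y) ?inE //= Gxy.
Qed.

(** In a simple graph a vertex has fewer than [#|X|] neighbours in [X]. If
    [#|X| <= delta], each vertex of [X] therefore sends at least
    [delta - #|X| + 1] edges out of [X], and
    [#|X| * (delta - #|X| + 1) >= delta]. *)
Lemma card_small_cut G X delta : (forall v, delta <= deg G v) ->
  X != set0 -> cut G X < delta -> delta < #|X|.
Proof.
move=> degG X0 ltc; rewrite ltnNge; apply/negP => leX.
suff: #|X| * (delta - #|X|).+1 <= cut G X.
  by move: X0; rewrite -card_gt0; nia.
rewrite -sum_nat_const; apply: leq_sum => x xX.
have := degG x; rewrite degE (bigID (mem X)) /=.
under [X in _ + X]eq_bigl => y do rewrite -in_setC.
suff: \sum_(y in X) G x y < #|X| by lia.
rewrite (cardD1 x) xX (bigD1 x) //= adj_irrefl add0n add1n ltnS.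
rewrite -sum1_card; under [X in _ <= X]eq_bigl => y do rewrite !inE andbC.
by apply: leq_sum => y _; apply: leq_b1.
Qed.

(** The [F]-neighbours of [c] cannot cover all [H]-neighbours of [a]: they are
    not more numerous, and one of them is [a] itself. *)
Lemma escape H F delta a c : delta <= deg H a -> deg F c <= delta -> F c a ->
  exists2 b, H a b & ~~ F c b.
Proof.
move=> degH degF Fca.
case: (pickP [pred b | H a b && ~~ F c b]) => [b /andP[] | none].
  by exists b.
suff: deg H a < deg F c by lia.
apply: proper_card; apply/properP; split.
  by apply/subsetP => b; rewrite !inE => Hab; have := none b; rewrite /= Hab => /negbFE.
by exists a; rewrite !inE ?adj_irrefl.
Qed.

(** Pairs with an end in the interior of [X] or [Y] are no edges of [H], so only
    [F] can obstruct a switch. If [F] joins an interior vertex [a] of [X] to an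
    interior vertex [c] of [Y], then [escape] applies in both directions. If
    not, choose all four vertices in the interiors: an interior vertex has at
    least [delta] neighbours, all in its set, and one of them is again
    interior. *)
Lemma exists_switch H F delta X Y :
  (forall v, delta <= deg H v) -> (forall v, deg F v <= delta) ->
  [disjoint X & Y] -> X != set0 -> Y != set0 ->
  cut H X < delta -> cut H Y < delta ->
  exists a b c d, [/\ [/\ a \in X, b \in X, c \in Y & d \in Y],
    H a b /\ H c d, ~~ H a d /\ ~~ H c b & ~~ F a d /\ ~~ F c b].
Proof.
move=> degH degF dXY X0 Y0 cX cY.
have inner T : T != set0 -> cut H T < delta -> exists a, a \in interior H T.
  move=> T0 cT; have ltT := card_small_cut degH T0 cT.
  by case: (meet_interior (subxx T) (ltn_trans cT ltT)) => a; exists a.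
have innerN T a : cut H T < delta -> a \in interior H T ->
    exists2 b, H a b & b \in interior H T.
  move=> cT aT; have sN : [set b | H a b] \subset T.
    by apply/subsetP => b; rewrite inE; apply: interiorP.
  case: (meet_interior sN (leq_trans cT (degH a))) => b.
  by rewrite inE; exists b.
have offX x y : x \in interior H X -> y \in Y -> ~~ H x y.
  move=> xX yY; apply/negP => /(interiorP xX) yX.
  by rewrite (disjointFr dXY yX) in yY.
have offY y x : y \in interior H Y -> x \in X -> ~~ H y x.
  move=> yY xX; apply/negP => /(interiorP yY) xY.
  by rewrite (disjointFr dXY xX) in xY.
case: (pickP [pred p : V * V |
    [&& p.1 \in interior H X, p.2 \in interior H Y & F p.1 p.2]])
  => [[a c] /and3P[/= aX cY' Fac] | none].
  have Fca : F c a by rewrite adj_sym.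
  have [b Hab Fcb] := escape (degH a) (degF c) Fca.
  have [d Hcd Fad] := escape (degH c) (degF a) Fac.
  have bX := interiorP aX Hab; have dY := interiorP cY' Hcd.
  exists a, b, c, d; split; split=> //.
  - exact: interiorS aX.
  - exact: interiorS cY'.
  - exact: offX aX dY.
  - exact: offY cY' bX.
have [a aX] := inner X X0 cX; have [c cY'] := inner Y Y0 cY.
have [b Hab bX] := innerN _ _ cX aX; have [d Hcd dY] := innerN _ _ cY cY'.
have noF x y : x \in interior H X -> y \in interior H Y -> ~~ F x y.
  by move=> xX yY; have := none (x, y); rewrite /= xX yY => /negbT.
exists a, b, c, d; split; split=> //.
- exact: interiorS aX.
- exact: interiorS bX.
- exact: interiorS cY'.
- exact: interiorS dY.
- exact: offX aX (interiorS dY).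
- exact: offY cY' (interiorS bX).
- exact: noF.
- by rewrite adj_sym noF.
Qed.

End Degrees.

(** * Switching two edges *)

Section Switch.
Variables (V : finType) (H : sgraph V) (a b c d : V).

Definition link (u v : V) : rel V :=
  fun x y => (x == u) && (y == v) || (x == v) && (y == u).

Definition switch_rel : rel V := fun x y =>
  [&& H x y, ~~ link a b x y & ~~ link c d x y] || link a d x y || link c b x y.

Lemma link_sym u v : symmetric (link u v).
Proof. by move=> x y; rewrite /link orbC [X in X || _]andbC [X in _ || X]andbC. Qed.

Lemma switch_sym : symmetric switch_rel.
Proof.
by move=> x y; rewrite /switch_rel adj_sym !(link_sym _ _ x y).
Qed.

Hypotheses (Hab : H a b) (Hcd : H c d) (Had : ~~ H a d) (Hcb : ~~ H c b).
Hypotheses (ac : a != c) (ad : a != d) (cb : c != b).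

Lemma link_irrefl u v x : u != v -> link u v x x = false.
Proof.
by move=> uv; rewrite /link [X in _ || X]andbC orbb; case: eqP => //= ->; apply: negPf.
Qed.

Lemma switch_irrefl : irreflexive switch_rel.
Proof.
by move=> x; rewrite /switch_rel adj_irrefl /= !link_irrefl.
Qed.

Definition switch : sgraph V := SGraph switch_sym switch_irrefl.

Lemma linkH u v x y : link u v x y -> H x y = H u v.
Proof. by case/orP => /andP[/eqP-> /eqP->] //; rewrite adj_sym. Qed.

(** Stated without subtraction, so that it sums over any set of pairs. *)
Lemma switchE x y :
  switch x y + link a b x y + link c d x y = H x y + link a d x y + link c b x y.
Proof.
have excl u v u' v' : u != u' -> u != v' -> ~~ (link u v x y && link u' v' x y).
  move=> n1 n2; apply/negP => /andP[/orP[] /andP[/eqP-> /eqP->]];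
  by rewrite /link (negPf n1) (negPf n2) ?andbF.
have ab : a != b by apply: contraTneq Hab => ->; rewrite adj_irrefl.
have kab : link a b x y ==> H x y by apply/implyP => /linkH->.
have kcd : link c d x y ==> H x y by apply/implyP => /linkH->.
have kad : link a d x y ==> ~~ H x y by apply/implyP => /linkH->.
have kcb : link c b x y ==> ~~ H x y by apply/implyP => /linkH->.
have := excl a b c d ac ad; have := excl a d c b ac ab.
rewrite /= /switch_rel; move: kab kcd kad kcb.
by case: (link a b x y); case: (link c d x y); case: (link a d x y);
  case: (link c b x y); case: (H x y).
Qed.

Lemma ecount_link (u v : V) S T : u != v ->
  ecount (link u v) S T = (u \in S) && (v \in T) + ((v \in S) && (u \in T)).
Proof.
move=> uv; rewrite -!ecount_pair -big_split; apply: eq_bigr => x _.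
rewrite -big_split; apply: eq_bigr => y _; rewrite /link.
by case: (eqVneq x u) => [->|]; case: eqP; rewrite ?(negPf uv) //=;
   do ?case: eqP.
Qed.

Lemma ecount_switch S T :
  ecount switch S T + ecount (link a b) S T + ecount (link c d) S T =
  ecount H S T + ecount (link a d) S T + ecount (link c b) S T.
Proof.
rewrite -!big_split; apply: eq_bigr => x _.
by rewrite -!big_split; apply: eq_bigr => y _; apply: switchE.
Qed.

Let ab : a != b. Proof. by apply: contraTneq Hab => ->; rewrite adj_irrefl. Qed.
Let cd : c != d. Proof. by apply: contraTneq Hcd => ->; rewrite adj_irrefl. Qed.

Lemma deg_switch v : deg switch v = deg H v.
Proof.
have degS G : deg G v = ecount G [set v] [set: V].
  by rewrite degE /ecount big_set1; apply: eq_bigl => y; rewrite inE.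
have := ecount_switch [set v] [set: V].
rewrite -(degS switch) -(degS H) !ecount_link //.
rewrite !in_set1 !in_setT !andbT.
by do 4![move: (nat_of_bool (_ == v)) => ?]; clear; lia.
Qed.

Lemma cut_switch Y :
  cut switch Y + ((a \in Y) != (b \in Y)) + ((c \in Y) != (d \in Y)) =
  cut H Y + ((a \in Y) != (d \in Y)) + ((c \in Y) != (b \in Y)).
Proof.
have := ecount_switch Y (~: Y); rewrite !ecount_link // !inE -!/(cut _ _).
move: (cut switch Y) (cut H Y) => m n.
by case: (a \in Y); case: (b \in Y); case: (c \in Y); case: (d \in Y); clear => /=; lia.
Qed.

End Switch.

(** * Raising small cuts by switches *)

Section Improvement.
Variable V : finType.
Implicit Types (H F : sgraph V) (S T X Y : {set V}).

Lemma minimal_small_cut H k Y : Y != set0 -> cut H Y < k ->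
  exists T, [/\ T \subset Y, T != set0, cut H T < k &
    forall A : {set V}, A \proper T -> A != set0 -> k <= cut H A].
Proof.
move=> Y0 cY; pose P A := (A != set0) && (cut H A < k).
have PY : P Y by rewrite /P Y0.
have [T /minsetP[/andP[T0 cT] minT] sTY] := minset_exists PY.
exists T; split=> // A AT A0; rewrite leqNgt; apply/negP => cA.
have eAT : A = T by apply: minT; [rewrite /P A0 | apply: proper_sub].
by rewrite eAT properxx in AT.
Qed.

(** Both parts of [T] are left by at least [k] edges although [T] itself is
    left by fewer than [k]; the surplus consists of the edges between the parts,
    each counted twice. *)
Lemma inner_cut H k T Y : cut H T < k ->
  (forall A : {set V}, A \proper T -> A != set0 -> k <= cut H A) ->
  T :&: Y != set0 -> T :\: Y != set0 -> k < 2 * ecount H (T :&: Y) (T :\: Y).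
Proof.
move=> cT minT I0 D0.
have dID : [disjoint T :&: Y & T :\: Y].
  by rewrite -setI_eq0; apply/eqP/setP => x; rewrite !inE; case: (x \in Y); rewrite ?andbF.
have := cut_split (@adj_sym _ H) dID; rewrite setID.
have I_proper : T :&: Y \proper T.
  rewrite properE subsetIl /=; apply: contraNN D0 => sTI.
  by rewrite setD_eq0 (subset_trans sTI) ?subsetIr.
have D_proper : T :\: Y \proper T.
  rewrite properE subsetDl /=; apply: contraNN I0 => sTD.
  rewrite setI_eq0; apply/pred0P => x /=; apply/negP => /andP[xT xY].
  by have := subsetP sTD x xT; rewrite inE xY.
have := minT _ I_proper I0; have := minT _ D_proper D0; lia.
Qed.

Lemma leq_inner_cuts H X T Y : [disjoint X & T] ->
  ecount H (X :&: Y) (X :\: Y) + ecount H (T :&: Y) (T :\: Y) <= cut H Y.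
Proof.
move=> dXT.
have d' : [disjoint X :&: Y & T :&: Y].
  exact: disjointWl (subsetIl _ _) (disjointWr (subsetIl _ _) dXT).
apply: leq_trans (leq_add (leq_ecount _ (subxx _) (subsetDr X Y))
  (leq_ecount _ (subxx _) (subsetDr T Y))) _.
by rewrite -ecountUl // leq_ecount // -setIUl subsetIr.
Qed.

(** The subtraction is truncated, so only cuts below [k] contribute. The empty
    and the full vertex set contribute the constant [k] each, which does not
    affect comparisons. *)
Definition deficiency k H : nat := \sum_(Y : {set V}) (k - cut H Y).

Definition avoids H F : Prop := forall x y, H x y -> ~~ F x y.

(** A switch between minimal small sets on the two sides of [Y] raises their
    cuts, and every cut that it lowers has at least [k + 2] edges before. *)
Lemma deficiency_decrease H F k delta Y : ~~ odd k -> k <= delta ->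
  (forall v, delta <= deg H v) -> (forall v, deg F v <= delta) ->
  avoids H F -> Y != set0 -> Y != setT -> cut H Y < k ->
  exists H' : sgraph V, [/\ forall v, deg H' v = deg H v, avoids H' F &
    deficiency k H' < deficiency k H].
Proof.
move=> evk lek degH degF HF Y0 YT cY.
have YC0 : ~: Y != set0 by apply: contraNneq YT => e; rewrite -(setCK Y) e setC0.
have cYC : cut H (~: Y) < k by rewrite cutC //; apply: adj_sym.
have [S [sSY S0 cS minS]] := minimal_small_cut Y0 cY.
have [T [sTY T0 cT minT]] := minimal_small_cut YC0 cYC.
have dST : [disjoint S & T].
  apply: disjointWl sSY (disjointWr sTY _).
  by rewrite -subsets_disjoint.
have [a [b [c [d [[aS bS cT' dT] [Hab Hcd] [Had Hcb] [Fad Fcb]]]]]] :=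
  exists_switch degH degF dST S0 T0 (leq_trans cS lek) (leq_trans cT lek).
have cX : c \notin S by rewrite (disjointFl dST cT').
have dX : d \notin S by rewrite (disjointFl dST dT).
have ac : a != c by apply: contraNneq cX => <-.
have ad : a != d by apply: contraNneq dX => <-.
have cb : c != b by apply: contraNneq cX => ->.
pose H' := switch H ad cb.
have cutH' : forall Z, _ := cut_switch Hab Hcd Had Hcb ac ad cb.
exists H'; split.
- exact: deg_switch.
- move=> x y /=; rewrite /switch_rel /link -orbA.
  case/or3P => [/andP[/HF//] | /orP[] /andP[/eqP-> /eqP->] | /orP[] /andP[/eqP-> /eqP->]] //;
    by rewrite adj_sym.
have mono Z : k - cut H' Z <= k - cut H Z.
  have := cutH' Z; rewrite -/H'; move: (cut H' Z) => cut'.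
  case: (boolP (((a \in Z) != (b \in Z)) && ((c \in Z) != (d \in Z)))); last first.
    by case: (a \in Z); case: (b \in Z); case: (c \in Z); case: (d \in Z) => //= _; clear; lia.
  (* Now Z splits S and T, and 2 * e > k forces e >= k / 2 + 1 as k is even. *)
  case/andP => ab cd.
  have meets (U : {set V}) u v : u \in U -> v \in U -> (u \in Z) != (v \in Z) ->
      U :&: Z != set0 /\ U :\: Z != set0.
    move=> uU vU; case uZ: (u \in Z); case vZ: (v \in Z) => // _.
      by split; apply/set0Pn; [exists u | exists v]; rewrite !inE ?uU ?vU ?uZ ?vZ.
    by split; apply/set0Pn; [exists v | exists u]; rewrite !inE ?uU ?vU ?uZ ?vZ.
  have [SI SD] := meets _ _ _ aS bS ab.
  have [TI TD] := meets _ _ _ cT' dT cd.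
  have := inner_cut cS minS SI SD; have := inner_cut cT minT TI TD.
  have := leq_inner_cuts H Z dST.
  have := odd_double_half k; rewrite (negPf evk).
  by rewrite ab cd; clear; lia.
rewrite /deficiency (bigD1 S) // [ltnRHS](bigD1 S) //= -addSn.
apply: leq_add; last by apply: leq_sum => Z _; apply: mono.
have := cutH' S; rewrite -/H' aS bS (negPf cX) (negPf dX) /=; move: cS; clear; lia.
Qed.

Theorem exists_highly_connected H F k delta : ~~ odd k -> k <= delta ->
  (forall v, delta <= deg H v) -> (forall v, deg F v <= delta) ->
  avoids H F ->
  exists H' : sgraph V, [/\ forall v, deg H' v = deg H v, avoids H' F &
    forall Y, Y != set0 -> Y != setT -> k <= cut H' Y].
Proof.
move=> evk lek degH degF HF.
have [n] := ubnP (deficiency k H).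
elim: n H degH HF => // n IHn H degH HF ltn.
case: (pickP [pred Y : {set V} | [&& Y != set0, Y != setT & cut H Y < k]]) => [Y | none].
  case/and3P => Y0 YT cY.
  have [H1 [deg1 HF1 lt1]] := deficiency_decrease evk lek degH degF HF Y0 YT cY.
  have [v|||H2 [deg2 HF2 cut2]] := IHn H1.
  - by rewrite deg1.
  - exact: HF1.
  - exact: leq_trans lt1 _.
  by exists H2; split=> // v; rewrite deg2.
exists H; split=> // Y Y0 YT; rewrite leqNgt.
by have := none Y; rewrite /= Y0 YT /= => ->.
Qed.

End Improvement.

(** * Edge-connectivity in terms of cuts *)

(** The operation [minn] has no neutral element on [nat], so the default value
    [d] takes part in the minimum. *)
Section MinFold.
Variables (I : finType) (d : nat) (P : pred I) (f : I -> nat).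

Lemma leq_bigminn m :
  m <= d -> (forall i, P i -> m <= f i) -> m <= \big[minn/d]_(i | P i) f i.
Proof. by move=> md mf; elim/big_ind: _ => // x y mx my; rewrite leq_min mx. Qed.

Lemma bigminn_leq_default : \big[minn/d]_(i | P i) f i <= d.
Proof. by elim/big_rec: _ => // i x _ xd; rewrite geq_min xd orbT. Qed.

Lemma bigminn_leq i : P i -> \big[minn/d]_(i | P i) f i <= f i.
Proof.
move=> Pi; have := mem_index_enum i; elim: (index_enum I) => // j s IHs.
rewrite inE big_cons => /predU1P[<-|/IHs le]; first by rewrite Pi geq_minl.
by case: ifP => // _; rewrite geq_min le orbT.
Qed.

End MinFold.

Section EdgeConnectivity.
Variable V : finType.
Implicit Types (G H F : sgraph V) (Y : {set V}).

Lemma edgesP G (A : {set V}) :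
  reflect (exists x y, G x y /\ A = [set x; y]) (A \in edges G).
Proof.
apply: (iffP imset2P) => [[x y _ Gxy ->] | [x [y [Gxy ->]]]].
  by exists x, y.
by exists x y.
Qed.

Lemma set2_inj (x y u v : V) : [set x; y] = [set u; v] ->
  x = u /\ y = v \/ x = v /\ y = u.
Proof.
move=> e.
have /set2P xe : x \in [set u; v] by rewrite -e set21.
have /set2P ye : y \in [set u; v] by rewrite -e set22.
have /set2P ue : u \in [set x; y] by rewrite e set21.
have /set2P ve : v \in [set x; y] by rewrite e set22.
by intuition congruence.
Qed.

Lemma mem_edges G x y : ([set x; y] \in edges G) = G x y.
Proof.
apply/edgesP/idP => [[u [v [Guv /set2_inj[][-> ->]]]] | Gxy] //.
  by rewrite adj_sym.
by exists x, y.
Qed.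

Lemma deg_leq_edges G v : deg G v <= #|edges G|.
Proof.
rewrite /deg -(@card_in_imset _ _ (fun w => [set v; w])) => [|w w' Hw Hw' /set2_inj].
  by apply/subset_leq_card/subsetP => _ /imsetP[w Gvw ->]; rewrite mem_edges -in_set.
by case=> [[]|[->]].
Qed.

(** Take for [Y] the vertices that remain reachable from [x], where the removal
    of [M] separates [x] from some [y]: every edge leaving [Y] was removed. *)
Lemma cut_leq_disconnecting G (M : {set {set V}}) :
  ~~ connected (del_edges G M) ->
  exists Y, [/\ Y != set0, Y != setT & cut G Y <= #|M|].
Proof.
case/forallPn => x /forallPn[y nxy]; pose Y := [set w | connect (del_edges G M) x w].
exists Y; split.
- by apply/set0Pn; exists x; rewrite inE connect0.
- by apply: contraNneq nxy => /setP/(_ y); rewrite !inE.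
pose E := [set p : V * V | [&& p.1 \in Y, p.2 \notin Y & G p.1 p.2]].
have -> : cut G Y = #|E|.
  rewrite /cut /ecount pair_big -sum1dep_card big_mkcond [RHS]big_mkcond /=.
  by apply: eq_bigr => -[u v] _; rewrite !inE /=;
    case: (connect _ x u); case: (connect _ x v); case: (G u v).
rewrite -(@card_in_imset _ _ (fun p => [set p.1; p.2])) => [|[u v] [u' v']].
  apply/subset_leq_card/subsetP => _ /imsetP[[u v] + ->].
  rewrite !inE /= => /and3P[xu xv Guv]; apply: contraNT xv => uvM.
  by apply: connect_trans xu (connect1 _); rewrite /= /del_rel Guv.
rewrite !inE /= => /and3P[xu xv _] /and3P[xu' xv' _] /set2_inj[[-> ->] // | [e _]].
by rewrite -e xu in xv'.
Qed.

Lemma leq_edge_connectivity G k : k <= min_degree G ->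
  (forall Y, Y != set0 -> Y != setT -> k <= cut G Y) ->
  k <= edge_connectivity G.
Proof.
move=> kmin kcut; apply: leq_bigminn => [|M /andP[_ dM]].
  case: (pickP V) => [v _ | V0].
    apply: leq_trans (leq_trans kmin _) (deg_leq_edges G v).
    exact: bigminn_leq.
  by apply: leq_trans (leq_trans kmin (bigminn_leq_default _ _ _)) _; rewrite (eq_card0 V0).
have [Y [Y0 YT cY]] := cut_leq_disconnecting dM.
exact: leq_trans (kcut Y Y0 YT) cY.
Qed.

(** Removing the edges at [v] isolates [v], which disconnects the graph unless
    [v] is the only vertex; in that case there are no edges at all. *)
Lemma edge_connectivity_leq G : edge_connectivity G <= min_degree G.
Proof.
have le_deg v : edge_connectivity G <= deg G v.
  pose M := [set [set v; w] | w in [set w | G v w]].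
  have sM : M \subset edges G.
    by apply/subsetP => _ /imsetP[w + ->]; rewrite inE mem_edges.
  case: (boolP (connected (del_edges G M))) => [con | dis]; last first.
    apply: leq_trans (leq_imset_card (fun w => [set v; w]) _).
    by apply: bigminn_leq; rewrite sM.
  have alone w : w = v.
    have /forallP/(_ v)/forallP/(_ w)/connectP[[|u p] /= path_p -> //] := con.
    case/andP: path_p => /andP[Gvu /negP[]].
    by apply/imsetP; exists u; rewrite ?inE.
  apply: leq_trans (bigminn_leq_default _ _ _) _.
  rewrite eq_card0 // => A; apply/edgesP => -[x [y []]].
  by rewrite (alone x) (alone y) adj_irrefl.
apply: leq_bigminn => [|v _]; last exact: le_deg.
case: (pickP V) => [v _ | V0].
  by apply: leq_trans (le_deg v) _; rewrite -cardsT subset_leq_card ?subsetT.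
apply: leq_trans (bigminn_leq_default _ _ _) _.
by rewrite eq_card0 // => A; apply/edgesP => -[x]; have := V0 x.
Qed.

(** * Realizations containing a given subgraph *)

Section Union.
Variables H F : sgraph V.

Definition union_rel : rel V := fun x y => H x y || F x y.

Lemma union_sym : symmetric union_rel.
Proof. by move=> x y; rewrite /union_rel !(adj_sym _ x). Qed.

Lemma union_irrefl : irreflexive union_rel.
Proof. by move=> x; rewrite /union_rel !adj_irrefl. Qed.

Definition union_graph : sgraph V := SGraph union_sym union_irrefl.

Lemma edges_union : edges F \subset edges union_graph.
Proof.
apply/subsetP => _ /edgesP[x [y [Fxy ->]]].
by rewrite mem_edges /= /union_rel Fxy orbT.
Qed.

Lemma del_union : avoids H F -> del_edges union_graph (edges F) =2 H.
Proof.
move=> HF x y; rewrite /= /del_rel mem_edges /= /union_rel.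
by case Hxy: (H x y); rewrite /= ?(negPf (HF _ _ Hxy)) //; case: (F x y).
Qed.

End Union.

Lemma eq_deg G H v : G =2 H -> deg G v = deg H v.
Proof. by move=> e; apply: eq_card => w; rewrite !inE e. Qed.

Lemma deg_del_edges G F v : edges F \subset edges G ->
  deg (del_edges G (edges F)) v + deg F v = deg G v.
Proof.
move=> /subsetP sFG; rewrite !degE -big_split; apply: eq_bigr => w _.
rewrite /= /del_rel mem_edges; case Fvw: (F v w); last by rewrite andbT addn0.
by have := sFG [set v; w]; rewrite !mem_edges andbF => ->.
Qed.

End EdgeConnectivity.

Theorem theorem3 (V : finType) (G0 F : sgraph V)
  (F_sub : edges F \subset edges G0)
  (deg_cond : max_degree F <= min_degree (del_edges G0 (edges F)))
  (edge_cond : min_degree G0 = 1 ->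
     #|V| - 1 <= #|edges (del_edges G0 (edges F))|) :
  exists G : sgraph V,
    realization G0 F G /\
    (~~ odd (min_degree (del_edges G (edges F))) ->
       maximally_edge_connected (del_edges G (edges F))) /\
    (odd (min_degree (del_edges G (edges F))) ->
       m_edge_connected (min_degree (del_edges G (edges F)) - 1)
         (del_edges G (edges F))).
Proof.
set H0 := del_edges G0 (edges F) in deg_cond *.
set delta := min_degree H0 in deg_cond.
have degH0 v : delta <= deg H0 v by apply: bigminn_leq.
have degF v : deg F v <= delta.
  by apply: leq_trans deg_cond; apply: (@leq_bigmax _ (deg F)).
have H0F : avoids H0 F by move=> x y /andP[_]; rewrite mem_edges.
pose k := delta - odd delta.
have evk : ~~ odd k.
  have le_odd : odd delta <= delta by case: (delta) => // n; case: (odd _).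
  by rewrite /k oddB // oddb addbb.
have [H [degH HF cutH]] :=
  exists_highly_connected evk (leq_subr _ _) degH0 degF H0F.
pose G := union_graph H F; exists G.
have DH := del_union HF; set D := del_edges G (edges F).
have degD v : deg D v = deg H0 v by rewrite (eq_deg v DH) degH.
have minD : min_degree D = delta by apply: eq_bigr => v _; apply: degD.
have lamD : k <= edge_connectivity D.
  apply: leq_edge_connectivity => [|Y Y0 YT]; first by rewrite minD leq_subr.
  by rewrite /cut (eq_ecount _ _ DH) cutH.
split; [split=> [v|] | rewrite minD; split=> par].
- by rewrite -(deg_del_edges v (edges_union H F)) degD deg_del_edges.
- exact: edges_union.
- apply/eqP; rewrite /maximally_edge_connected eqn_leq edge_connectivity_leq.
  by rewrite minD; move: lamD; rewrite /k (negPf par) subn0.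
- by move: lamD; rewrite /k par.
Qed.
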